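(* If $K,L\in\mathcal{F}$ are reversible and $K\preceq L$, then for every $t = 0,1,2,\ldots$ we have $K^t,L^t\in\mathcal{F}$ and $K^t\preceq L^t$.
   Context: $\mathcal{X}$ is a given finite partially ordered set and $\pi$ is a given probability mass function on $\mathcal{X}$ with $\pi(i)>0$ for all $i$. For $f,g:\mathcal{X}\to\mathbf{R}$ put $\langle f,g\rangle=\sum_{i\in\mathcal{X}}\pi(i)f(i)g(i)$. A kernel $K$ acts on functions by $(Kf)(i)=\sum_j K(i,j)f(j)$. $\mathcal{K}$ is the set of Markov kernels (row-stochastic matrices) on $\mathcal{X}$ having $\pi$ as stationary distribution ($\pi K=\pi$). $\mathcal{M}$ is the set of nonnegative nonincreasing functions on $\mathcal{X}$ (that is, $x\le y$ implies $f(x)\ge f(y)$). $\mathcal{F}$ is the set of $K\in\mathcal{K}$ that are stochastically monotone, meaning $Kf\in\mathcal{M}$ for every $f\in\mathcal{M}$. $K\in\mathcal{K}$ is reversible if it is self-adjoint on $L^2(\pi)$, i.e. $\pi(i)K(i,j)=\pi(j)K(j,i)$ for all $i,j$. For $K,L\in\mathcal{K}$ write $K\preceq L$ (a comparison inequality) if $\langle Kf,g\rangle\le\langle Lf,g\rangle$ for all $f,g\in\mathcal{M}$. *)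

(* Defs.v *)
From mathcomp Require Import all_boot all_order all_algebra.

Set Implicit Arguments.
Unset Strict Implicit.
Unset Printing Implicit Defensive.

Import Order.TTheory GRing.Theory Num.Theory.
Local Open Scope ring_scope.

(* Kernels are written as functions X -> X -> R rather than as matrices
   'M[R]_#|X|, so that entries are indexed directly by the states of the
   poset X. Since only the ordered-field structure
   is used, R is any realFieldType. *)

Section Kernels.

Variables (R : realFieldType) (d : Order.disp_t) (X : finPOrderType d).
Implicit Types (pi f g : X -> R) (K L : X -> X -> R).

Definition positive_pmf pi : Prop :=
  (forall i, 0 < pi i) /\ \sum_i pi i = 1.

Definition inner pi f g : R := \sum_i pi i * f i * g i.

Definition kact K f : X -> R := fun i => \sum_j K i j * f j.

Definition kid : X -> X -> R := fun i j => (i == j)%:R.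

Definition kmul K L : X -> X -> R := fun i j => \sum_k K i k * L k j.

Definition kpow K (t : nat) : X -> X -> R := iter t (kmul K) kid.

Definition row_stochastic K : Prop :=
  (forall i j, 0 <= K i j) /\ (forall i, \sum_j K i j = 1).

Definition stationary pi K : Prop := forall j, \sum_i pi i * K i j = pi j.

(* The class written \mathcal{K}. *)
Definition markov_kernel pi K : Prop := row_stochastic K /\ stationary pi K.

(* The class written \mathcal{M}; note the order reversal. *)
Definition nonneg_nonincreasing f : Prop :=
  (forall x, 0 <= f x) /\ (forall x y, (x <= y)%O -> f y <= f x).

(* The class written \mathcal{F}. *)
Definition monotone_kernel pi K : Prop :=
  markov_kernel pi K /\
  (forall f, nonneg_nonincreasing f -> nonneg_nonincreasing (kact K f)).

Definition reversible pi K : Prop :=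
  forall i j, pi i * K i j = pi j * K j i.

(* The comparison inequality written K \preceq L. *)
Definition comparison pi K L : Prop :=
  forall f g, nonneg_nonincreasing f -> nonneg_nonincreasing g ->
    inner pi (kact K f) g <= inner pi (kact L f) g.

End Kernels.

(* Main.v *)
Require Import Defs.
From mathcomp Require Import all_boot all_order all_algebra.

(** Comparison is compatible with products of kernels.  Suppose [K1] is below
    [L1] and [K2] is below [L2], with [K2] and [L1] monotone and [L1] reversible.
    For [f] and [g] nonnegative and nonincreasing,
    <K1 K2 f, g> <= <L1 K2 f, g> = <K2 f, L1 g> <= <L2 f, L1 g> = <L1 L2 f, g>.
    The first inequality tests the first comparison on [K2 f], the second tests
    the other one on [L1 g]; monotonicity makes both of these legitimate test
    functions, and self-adjointness of [L1] moves it across the inner product.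
    Since monotone kernels are closed under products, induction on [t], with
    [K1 = K], [L1 = L] and [K2], [L2] the previous powers, gives the claim. *)

Set Implicit Arguments.
Unset Strict Implicit.
Unset Printing Implicit Defensive.

Import Order.TTheory GRing.Theory Num.Theory.
Local Open Scope ring_scope.

Section KernelProducts.

Variables (R : realFieldType) (d : Order.disp_t) (X : finPOrderType d).
Implicit Types (pi f g : X -> R) (K L : X -> X -> R).

Lemma kact_kid f : kact (@kid R d X) f =1 f.
Proof.
move=> i; rewrite /kact /kid (bigD1 i) //= eqxx mul1r big1 ?addr0 // => j.
by rewrite eq_sym => /negbTE ->; rewrite mul0r.
Qed.

Lemma kact_kmul K L f : kact (kmul K L) f =1 kact K (kact L f).
Proof.
move=> i; rewrite /kact /kmul.
under eq_bigr do rewrite mulr_suml.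
rewrite exchange_big; apply: eq_bigr => k _.
by rewrite mulr_sumr; apply: eq_bigr => j _; rewrite mulrA.
Qed.

Lemma eq_inner pi f f' g : f =1 f' -> inner pi f g = inner pi f' g.
Proof. by move=> ff'; apply: eq_bigr => i _; rewrite ff'. Qed.

Lemma eq_nonneg_nonincreasing f f' :
  f =1 f' -> nonneg_nonincreasing f -> nonneg_nonincreasing f'.
Proof.
by move=> ff' [f0 fle]; split=> [x|x y xy]; rewrite -!ff' //; apply: fle.
Qed.

Lemma monotone_kernel_kid pi : monotone_kernel pi (@kid R d X).
Proof.
split; last first.
  by move=> f; apply: eq_nonneg_nonincreasing => i; rewrite kact_kid.
split; first split=> [i j|i]; first exact: ler0n.
- rewrite -[RHS](kact_kid (fun=> 1) i).
  by apply: eq_bigr => j _; rewrite mulr1.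
- move=> j; rewrite -[RHS](kact_kid pi j).
  by apply: eq_bigr => i _; rewrite /kid eq_sym mulrC.
Qed.

Lemma monotone_kernel_kmul pi K L :
  monotone_kernel pi K -> monotone_kernel pi L ->
  monotone_kernel pi (kmul K L).
Proof.
move=> [[[K0 K1] piK] monoK] [[[L0 L1] piL] monoL].
split; last first.
  move=> f /monoL/monoK; apply: eq_nonneg_nonincreasing => i.
  by rewrite kact_kmul.
split; first split=> [i j|i].
- by apply: sumr_ge0 => k _; apply: mulr_ge0.
- rewrite exchange_big -[RHS](K1 i); apply: eq_bigr => k _.
  by rewrite -mulr_sumr L1 mulr1.
- move=> j; rewrite -[RHS]piL.
  under eq_bigr do rewrite mulr_sumr.
  rewrite exchange_big; apply: eq_bigr => k _.
  by rewrite -piK mulr_suml; apply: eq_bigr => i _; rewrite mulrA.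
Qed.

Lemma inner_kact_reversible pi K f g :
  reversible pi K -> inner pi (kact K f) g = inner pi f (kact K g).
Proof.
move=> revK; rewrite /inner /kact.
under eq_bigr do rewrite mulr_sumr mulr_suml.
rewrite exchange_big; apply: eq_bigr => j _.
rewrite mulr_sumr; apply: eq_bigr => i _.
by rewrite !mulrA revK [pi j * K j i * f j]mulrAC.
Qed.

(** The outer factor of the larger product is moved onto [g], so that the
    inner factors can be compared while the test functions stay in the cone. *)
Lemma comparison_kmul pi K1 L1 K2 L2 :
  monotone_kernel pi L1 -> reversible pi L1 -> monotone_kernel pi K2 ->
  comparison pi K1 L1 -> comparison pi K2 L2 ->
  comparison pi (kmul K1 K2) (kmul L1 L2).
Proof.
move=> [_ monoL1] revL1 [_ monoK2] le1 le2 f g f_mono g_mono.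
rewrite !(eq_inner _ _ (kact_kmul _ _ f)).
apply: le_trans (le1 _ _ (monoK2 _ f_mono) g_mono) _.
by rewrite !(inner_kact_reversible _ _ revL1); apply: le2 => //; apply: monoL1.
Qed.

Lemma monotone_kernel_kpow pi K t :
  monotone_kernel pi K -> monotone_kernel pi (kpow K t).
Proof.
move=> monoK; elim: t => [|t IHt]; first exact: monotone_kernel_kid.
exact: monotone_kernel_kmul.
Qed.

End KernelProducts.

Theorem corollary2p5 (R : realFieldType) (d : Order.disp_t)
    (X : finPOrderType d) (pi : X -> R) (hpi : positive_pmf pi)
    (K L : X -> X -> R)
    (hK : monotone_kernel pi K) (hL : monotone_kernel pi L)
    (revK : reversible pi K) (revL : reversible pi L)
    (hKL : comparison pi K L) (t : nat) :
  [/\ monotone_kernel pi (kpow K t),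
      monotone_kernel pi (kpow L t)
    & comparison pi (kpow K t) (kpow L t)].
Proof.
split; [exact: monotone_kernel_kpow | exact: monotone_kernel_kpow |].
elim: t => [|t IHt]; first by move=> f g _ _; apply: lexx.
by apply: comparison_kmul => //; apply: monotone_kernel_kpow.
Qed.
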